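(* For every integer $n\ge 1$, the base change map $\mathcal{BC}:\mathcal{A}^t_n(\mathbb{R})\to\mathcal{A}^t_n(\mathbb{C})$ is a continuous proper map.
   Context: Characters. For $\ell\in\mathbb{Z}$, $t\in\mathbb{R}$ let $\chi_{\ell,t}(z)=(z/|z|)^{\ell}|z|^{it}$ be the corresponding unitary character of $\mathbb{C}^\times$ (usual modulus), and for $\varepsilon\in\{0,1\}$, $t\in\mathbb{R}$ let $\xi_{\varepsilon,t}(x)=(x/|x|)^{\varepsilon}|x|^{it}$ be the corresponding unitary character of $\mathbb{R}^\times$. Let $\tau$ be complex conjugation and $\chi^\tau(z)=\chi(\bar z)$, so $\chi_{\ell,t}^\tau=\chi_{-\ell,t}$. Let $N:\mathbb{C}^\times\to\mathbb{R}^\times$, $N(z)=z\bar z$; thus $\xi_{\varepsilon,t}\circ N=\chi_{0,2t}$. For $\ell\ne 0$ the character $\chi=\chi_{\ell,t}$ defines an irreducible representation $\pi(\chi)$ of $GL(2,\mathbb{R})$, square-integrable modulo the center (the one whose Langlands parameter is the representation of the Weil group $W_{\mathbb{R}}=\mathbb{C}^\times\sqcup j\mathbb{C}^\times$, $j^2=-1$, $jcj^{-1}=\bar c$, induced from the character $\chi$ of $W_{\mathbb{C}}=\mathbb{C}^\times$); one has $\pi(\chi)=\pi(\chi^\tau)$. Tempered duals as topological spaces (Harish-Chandra parameter spaces). The tempered dual $\mathcal{A}^t_n(\mathbb{R})$ of $GL(n,\mathbb{R})$ consists of the classes of the parabolically induced representations $$\pi(\chi_1,\dots,\chi_q,\xi_1,\dots,\xi_r)=i_{GL(n,\mathbb{R}),MN}(\pi(\chi_1)\otimes\cdots\otimes\pi(\chi_q)\otimes\xi_1\otimes\cdots\otimes\xi_r\otimes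 1),$$ where $n=2q+r$, $M\cong GL(2,\mathbb{R})^q\times GL(1,\mathbb{R})^r$, $\chi_i=\chi_{\ell_i,t_i}$ with $\ell_i\ge 1$, and $\xi_j=\xi_{\varepsilon_j,t'_j}$; two such are equivalent iff they have the same $(q,r)$ and differ by a permutation in $S_q$ of the $\chi_i$ and a permutation in $S_r$ of the $\xi_j$. It is topologized as the disjoint union, over $(q,r)$ with $n=2q+r$ and over orbits of $S_q\times S_r$ on discrete labels $\sigma=(\ell_1,\dots,\ell_q;\varepsilon_1,\dots,\varepsilon_r)$ (one representative $\sigma$ per orbit), of the quotient spaces $\mathbb{R}^{q+r}/W_\sigma$, where $W_\sigma\subset S_q\times S_r$ is the stabilizer of $\sigma$, acting by permuting the coordinates $(t_1,\dots,t_q,t'_1,\dots,t'_r)$. Similarly, the tempered dual $\mathcal{A}^t_n(\mathbb{C})$ of $GL(n,\mathbb{C})$ consists of the classes of the unitary principal series $i_{GL(n,\mathbb{C}),B(\mathbb{C})}(\chi_{\ell_1,t_1},\dots,\chi_{\ell_n,t_n})$, with $B$ the Borel subgroup, up to permutation of the characters, topologized as the disjoint union over $S_n$-orbits of $\sigma=(\ell_1,\dots,\ell_n)\in\mathbb{Z}^n$ of the spaces $\mathbb{R}^n/W_\sigma$, where $W_\sigma\subset S_n$ is the stabilizer of $\sigma$ acting on $(t_1,\dots,t_n)$. Base change. $\mathcal{BC}$ corresponds under the local Langlands correspondence to restriction of Langlands parameters from $W_{\mathbb{R}}$ to $W_{\mathbb{C}}$; explicitly $$\mathcal{BC}\big(\pi(\chi_1,\dots,\chi_q,\xi_1,\dots,\xi_r)\big)=i_{GL(n,\mathbb{C}),B(\mathbb{C})}(\chi_1,\chi_1^\tau,\dots,\chi_q,\chi_q^\tau,\xi_1\circ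 N,\dots,\xi_r\circ N).$$ A map of locally compact Hausdorff spaces is proper if preimages of compact sets are compact. *)

(* Defs.v *)
From HB Require Import structures.
From mathcomp Require Import all_boot all_order all_fingroup all_algebra.
From mathcomp Require Import complex.
From mathcomp Require Import all_classical all_reals all_analysis.
From mathcomp Require Import generic_quotient.

Set Implicit Arguments.
Unset Strict Implicit.
Unset Printing Implicit Defensive.
Import Order.TTheory GRing.Theory Num.Theory.
Import numFieldNormedType.Exports.
Local Open Scope classical_set_scope.
Local Open Scope ring_scope.
Local Open Scope quotient_scope.

(** Unitary characters of C^* and R^*, as total functions whose value at 0 is
    irrelevant.  The pair (l, t) encodes chi_{l,t} and the pair (e, t) encodes
    xi_{e,t}; by [chi_inj] and [xi_inj] these encodings are faithful. *)
Section Characters.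
Variable R : realType.
Local Notation C := R[i].

(** x^(it) is [cis (t * ln x)], for x > 0 *)
Definition cis (a : R) : C := (cos a +i* sin a)%C.

Definition charC : Type := (int * R)%type.
Definition charR : Type := (bool * R)%type.

Definition chi (c : charC) (z : C) : C :=
  (z / `|z|) ^ c.1 * cis (c.2 * ln (complex.Re `|z|)).

Definition xi (c : charR) (x : R) : C :=
  ((x / `|x|) ^+ c.1)%:C%C * cis (c.2 * ln `|x|).

(** the norm N : C^* -> R^* *)
Definition normCR (z : C) : R := complex.Re (z * z^*%C).

(** chi^tau and xi o N, see [chi_tau] and [xi_norm] *)
Definition char_tau (c : charC) : charC := (- c.1, c.2).
Definition char_norm (c : charR) : charC := (0, 2 * c.2).

Lemma cis0 : cis 0 = 1.
Proof. by rewrite /cis cos0 sin0. Qed.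

Lemma cisD a b : cis (a + b) = cis a * cis b.
Proof.
by rewrite /cis cosD sinD; apply/eqP; rewrite eq_complex /= eqxx/= addrC eqxx.
Qed.

Lemma norm_ReE (z : C) : `|z| = (complex.Re `|z|)%:C%C.
Proof. by case: z. Qed.

Lemma cis_inj_scale t t' : (forall s, cis (t * s) = cis (t' * s)) -> t = t'.
Proof.
move=> h; apply/eqP; rewrite -subr_eq0; apply/negP => /negP d0.
have := congr1 (fun w => w * cis (- (t' * (trigo.pi / (t - t')))))
  (h (trigo.pi / (t - t'))).
rewrite /= -!cisD subrr cis0 -mulrBl mulrC divfK// /cis cospi => /eqP.
by rewrite eq_complex /= -subr_eq0 -opprD oppr_eq0 (pnatr_eq0 R 2).
Qed.

Lemma cisXz a (l : int) : cis a ^ l = cis (l%:~R * a).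
Proof.
have cisX m : cis a ^+ m = cis (m%:R * a).
  elim: m => [|m IH]; first by rewrite expr0 mul0r cis0.
  by rewrite exprS IH -cisD -natr1 addrC mulrDl mul1r.
case: l => m; first exact: cisX.
rewrite NegzE -invr_expz -exprnP cisX mulrNz mulNr.
apply: (mulIf (x := cis (m.+1%:R * a))); last first.
  by rewrite -cisD addNr cis0 mulVf// -unitfE; apply/unitrPr;
    exists (cis (- (m.+1%:R * a))); rewrite -cisD subrr cis0.
rewrite -unitfE; apply/unitrPr.
by exists (cis (- (m.+1%:R * a))); rewrite -cisD subrr cis0.
Qed.

Lemma norm_cis a : `|cis a| = 1.
Proof. by rewrite normc_def /= cos2Dsin2 sqrtr1. Qed.

Lemma chi_tau c z : z != 0 -> chi (char_tau c) z = chi c z^*%C.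
Proof.
move=> z0; rewrite /chi normcJ; congr (_ * _).
rewrite [(char_tau c).1]/=.
have nz0 : `|z| != 0 by rewrite normr_eq0.
suff -> : z^*%C / `|z| = (z / `|z|)^-1 by rewrite exprz_inv.
apply: (mulIf (x := z / `|z|)); first by rewrite mulf_neq0 ?invr_neq0.
rewrite mulVf ?mulf_neq0 ?invr_neq0// mulrACA [_ * z]mulrC -sqr_normc.
by rewrite expr2 mulrACA mulfV// mulr1.
Qed.

Lemma xi_norm c z : z != 0 -> chi (char_norm c) z = xi c (normCR z).
Proof.
move=> z0; have nz : 0 < complex.Re `|z|.
  by rewrite -ltcR -norm_ReE normr_gt0.
have -> : normCR z = complex.Re `|z| ^+ 2.
  by rewrite /normCR -sqr_normc norm_ReE -rmorphXn.
have n2 : 0 < complex.Re `|z| ^+ 2 by rewrite exprn_gt0.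
rewrite /chi /xi /= expr0z ger0_norm ?ltW// divff ?gt_eqF// expr1n.
by rewrite lnXn// mul1r rmorph1 mul1r mulrnAr -mulrA mulr_natl.
Qed.

Lemma chi_inj c c' : (forall z, z != 0 -> chi c z = chi c' z) -> c = c'.
Proof.
case: c c' => [l t] [l' t'] h.
have tt' : t = t'.
  apply: cis_inj_scale => s.
  have e0 : (expR s)%:C%C != 0 by rewrite eq_complex /= gt_eqF ?expR_gt0.
  have en : `|(expR s)%:C%C| = (expR s)%:C%C :> C.
    by rewrite ger0_norm// lecR expR_ge0.
  by have := h _ e0; rewrite /chi en divff//= !exp1rz !mul1r expRK.
have ll' : l%:~R = l'%:~R :> R.
  apply: cis_inj_scale => s.
  have e0 : cis s != 0 by rewrite -normr_eq0 norm_cis oner_neq0.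
  have := h _ e0; rewrite /chi norm_cis divr1 /= ln1 !mulr0 cis0 !mulr1.
  by rewrite !cisXz.
by rewrite tt'; congr (_, _); apply/eqP; rewrite -(eqr_int R) ll'.
Qed.

Lemma xi_inj c c' : (forall x, x != 0 -> xi c x = xi c' x) -> c = c'.
Proof.
case: c c' => [e t] [e' t'] h.
have tt' : t = t'.
  apply: cis_inj_scale => s.
  have e0 : expR s != 0 by rewrite gt_eqF ?expR_gt0.
  have := h _ e0; rewrite /xi /= gtr0_norm ?expR_gt0// divff// !expr1n !mul1r.
  by rewrite expRK.
have n0 : -1 != 0 :> R by rewrite oppr_eq0 oner_neq0.
have := h _ n0; rewrite tt' /xi /= normrN1 divr1 ln1 !mulr0 cis0 !mulr1.
move=> /eqP; rewrite eq_complex /= eqxx andbT.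
by case: e e' {h} => -[] //=; rewrite expr1 expr0 -subr_eq0 ?opprK -?opprD
  ?oppr_eq0 (pnatr_eq0 R 2).
Qed.

End Characters.

(** Let a finite group act on a set L of discrete labels and on a space V.  The
    parameter space is the disjoint union, over the orbits in L with chosen
    representative s, of the quotients V / Stab(s). *)
Section ParameterSpace.
Variables (gT : finGroupType) (L : choiceType) (V : topologicalType).
Variables (aL : {action gT &-> L}) (aV : {action gT &-> V}).

Definition orbit_rel : rel L := fun l l' => [exists g, aL l g == l'].
Definition stab_rel (l : L) : rel V :=
  fun v v' => [exists g, (aL l g == l) && (aV v g == v')].

Lemma tact1 (T : Type) (a : {action gT &-> T}) x : a x 1%g = x.
Proof. by case: a => to [inj M]; apply: (inj 1%g); rewrite /= -M ?inE ?mulg1. Qed.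

Lemma tactM (T : Type) (a : {action gT &-> T}) x g h :
  a x (g * h)%g = a (a x g) h.
Proof. by case: a => to [inj M]; rewrite /= M ?inE. Qed.

Lemma tactK (T : Type) (a : {action gT &-> T}) x g : a (a x g) g^-1%g = x.
Proof. by rewrite -tactM mulgV tact1. Qed.

Lemma orbit_rel_equiv : equiv_class_of orbit_rel.
Proof.
split=> [x|x y|y x z].
- by apply/existsP; exists 1%g; rewrite tact1.
- by apply/existsP/existsP => -[g /eqP <-]; exists g^-1%g; rewrite tactK.
- move=> /existsP[g /eqP <-] /existsP[h /eqP <-].
  by apply/existsP; exists (g * h)%g; rewrite tactM.
Qed.

Lemma stab_rel_equiv l : equiv_class_of (stab_rel l).
Proof.
split=> [x|x y|y x z].
- by apply/existsP; exists 1%g; rewrite !tact1 !eqxx.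
- by apply/existsP/existsP => -[g /andP[/eqP lg /eqP <-]]; exists g^-1%g;
    rewrite tactK -{1}lg tactK !eqxx.
- move=> /existsP[g /andP[/eqP lg /eqP <-]] /existsP[h /andP[/eqP lh /eqP <-]].
  by apply/existsP; exists (g * h)%g; rewrite !tactM lg lh !eqxx.
Qed.

Canonical orbit_equiv := EquivRelPack orbit_rel_equiv.
Canonical stab_equiv l := EquivRelPack (stab_rel_equiv l).

Definition label_orbit : choiceType := {eq_quot orbit_rel}.

Definition stratum (o : label_orbit) : topologicalType :=
  quotient_topology {eq_quot stab_rel (repr o)}.

Definition param_space : topologicalType := {o : label_orbit & stratum o}.

Definition label_class (l : L) : label_orbit := \pi_({eq_quot orbit_rel}) l.

Lemma to_repr_subproof (l : L) : exists g, aL l g == repr (label_class l).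
Proof.
apply/existsP; apply/(@eqmodP _ orbit_equiv); exact: esym (reprK _).
Qed.

(** the point with label l and coordinates v: a group element carries (l, v) to
    the representative of the orbit of l *)
Definition param_class (l : L) (v : V) : param_space :=
  existT stratum (label_class l)
    (\pi_({eq_quot stab_rel (repr (label_class l))})
       (aV v (xchoose (to_repr_subproof l)))).

Definition param_repr (x : param_space) : L * V :=
  (repr (projT1 x), repr (projT2 x)).

Lemma param_classE l v (o : label_orbit) g (lo : label_class l = o) :
  aL l g = repr o ->
  param_class l v =
  existT stratum o (\pi_({eq_quot stab_rel (repr o)}) (aV v g)).
Proof.
subst o => lg; rewrite /param_class; congr existT.
apply/(@eqmodP _ (stab_equiv _)); apply/existsP.
exists ((xchoose (to_repr_subproof l))^-1 * g)%g.
have /eqP lh := xchooseP (to_repr_subproof l).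
by rewrite -{1}lh !tactM !tactK lg !eqxx.
Qed.

Lemma param_classP l v l' v' :
  param_class l v = param_class l' v' <-> exists g, aL l g = l' /\ aV v g = v'.
Proof.
split=> [E|[g [<- <-]]].
- have [h /eqP lh] := to_repr_subproof l.
  have [h' /eqP lh'] := to_repr_subproof l'.
  have Eo : label_class l = label_class l' := congr1 (@projT1 _ _) E.
  rewrite -Eo in lh'; move: E.
  rewrite (param_classE v erefl lh) (param_classE v' (esym Eo) lh').
  move=> /(@eq_from_Tagged _ stratum _ _ _).
  move=> /(@eqmodP _ (stab_equiv _))/existsP[g /andP[/eqP rg /eqP vg]].
  exists (h * g * h'^-1)%g; rewrite !tactM lh rg vg tactK.
  by rewrite -lh' tactK.
- have [h /eqP lh] := to_repr_subproof (aL l g).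
  have Eo : label_class l = label_class (aL l g).
    by apply/(@eqmodP _ orbit_equiv); apply/existsP; exists g.
  rewrite (param_classE (aV v g) erefl lh).
  by rewrite -tactM; rewrite -tactM in lh; rewrite (param_classE v Eo lh).
Qed.

Lemma param_reprK x : param_class (param_repr x).1 (param_repr x).2 = x.
Proof.
case: x => o w; rewrite /param_repr /=.
have oE : label_class (repr o) = o by exact: reprK.
rewrite (param_classE _ oE (tact1 aL _)) tact1; congr existT; exact: reprK.
Qed.

End ParameterSpace.

Section TemperedDuals.
Variable R : realType.

Definition perm_ffun (T : Type) n (f : {ffun 'I_n -> T}) (s : 'S_n) :
  {ffun 'I_n -> T} := [ffun i => f (s^-1%g i)].
Definition perm_rV n (v : 'rV[R]_n) (s : 'S_n) : 'rV[R]_n :=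
  col_perm s^-1%g v.

Lemma perm_ffun1 T n : (@perm_ffun T n)^~ 1%g =1 id.
Proof. by move=> f; apply/ffunP => i; rewrite ffunE invg1 perm1. Qed.
Lemma perm_ffunM T n (f : {ffun 'I_n -> T}) : act_morph (@perm_ffun T n) f.
Proof. by move=> s t; apply/ffunP => i; rewrite !ffunE invMg permM. Qed.
Lemma perm_rV1 n : (@perm_rV n)^~ 1%g =1 id.
Proof. by move=> v; rewrite /perm_rV invg1 col_perm1. Qed.
Lemma perm_rVM n (v : 'rV[R]_n) : act_morph (@perm_rV n) v.
Proof. by move=> s t; rewrite /perm_rV invMg col_permM. Qed.

Canonical perm_ffun_action T n := TotalAction (@perm_ffun1 T n) (@perm_ffunM T n).
Canonical perm_rV_action n := TotalAction (@perm_rV1 n) (@perm_rVM n).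

Section ProductAction.
Variables (gT hT : finGroupType) (T U : Type).
Variables (a : {action gT &-> T}) (b : {action hT &-> U}).
Definition prod_act (x : T * U) (g : gT * hT) : T * U := (a x.1 g.1, b x.2 g.2).
Lemma prod_act1 : prod_act^~ 1%g =1 id.
Proof. by move=> [x y]; rewrite /prod_act !tact1. Qed.
Lemma prod_actM x : act_morph prod_act x.
Proof. by move=> g h; rewrite /prod_act !tactM. Qed.
Canonical prod_action := TotalAction prod_act1 prod_actM.
End ProductAction.

(** The tempered duals are Harish-Chandra's parameter spaces: a tempered
    representation is the class of its inducing data, and [piC], [piR] send
    inducing data to the corresponding point.

    ** GL(n, C) *)

Definition temperedC (n : nat) : topologicalType :=
  param_space (perm_ffun_action int n) (perm_rV_action n).

(** the class of the unitary principal series i(c_1, ..., c_n) *)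
Definition piC n (c : n.-tuple (charC R)) : temperedC n :=
  param_class (perm_ffun_action int n) (perm_rV_action n)
    [ffun i => (tnth c i).1] (\row_i (tnth c i).2).

Lemma perm_actP (A : eqType) n (c c' : n.-tuple (A * R)) :
  (exists g, perm_ffun [ffun i => (tnth c i).1] g = [ffun i => (tnth c' i).1] /\
     perm_rV (\row_i (tnth c i).2) g = \row_i (tnth c' i).2) <-> perm_eq c c'.
Proof.
split.
- move=> [g [/ffunP/= E1 /rowP/= E2]]; rewrite perm_sym.
  apply/tuple_permP; exists g^-1%g; congr tval; apply: eq_from_tnth => i.
  have := E1 i; have := E2 i; rewrite tnth_mktuple !(ffunE, mxE).
  by case: (tnth c' i) => a b /= <- <-; case: (tnth c _).
- rewrite perm_sym => /tuple_permP[g /val_inj ->].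
  exists g^-1%g; split; [apply/ffunP|apply/rowP] => i /=;
    by rewrite !(ffunE, mxE) invgK tnth_mktuple.
Qed.

(** equivalence of principal series: equality up to permutation *)
Lemma piC_eq n (c c' : n.-tuple (charC R)) : piC c = piC c' <-> perm_eq c c'.
Proof. by apply: iff_trans (perm_actP c c'); exact: param_classP. Qed.

(** ** GL(n, R) *)

(** the pairs (q, r) with n = 2q + r, for the Levi GL(2)^q x GL(1)^r *)
Definition levi_type (n : nat) : choiceType :=
  {s : nat * nat | n == (2 * s.1 + s.2)%N}.

(** the labels l >= 1 of the square-integrable representations of GL(2, R) *)
Definition dsLabel : choiceType := {l : int | 1 <= l}.
Definition dsChar : Type := (dsLabel * R)%type.
Definition charC_of_ds (c : dsChar) : charC R := (val c.1, c.2).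

Definition temperedR_shape (q r : nat) : topologicalType :=
  param_space
    (prod_action (perm_ffun_action dsLabel q) (perm_ffun_action bool r))
    (prod_action (perm_rV_action q) (perm_rV_action r)).

Definition temperedR (n : nat) : topologicalType :=
  {s : levi_type n & temperedR_shape (val s).1 (val s).2}.

(** the class of pi(chi_1, ..., chi_q, xi_1, ..., xi_r) *)
Definition piR n (s : levi_type n) (x : (val s).1.-tuple dsChar)
    (y : (val s).2.-tuple (charR R)) : temperedR n :=
  existT (fun s : levi_type n => temperedR_shape (val s).1 (val s).2) s
    (param_class
      (prod_action (perm_ffun_action dsLabel _) (perm_ffun_action bool _))
      (prod_action (perm_rV_action _) (perm_rV_action _))
      ([ffun i => (tnth x i).1], [ffun j => (tnth y j).1])
      (\row_i (tnth x i).2, \row_j (tnth y j).2)).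

Lemma piR_eq n (s : levi_type n) (x x' : (val s).1.-tuple dsChar)
    (y y' : (val s).2.-tuple (charR R)) :
  piR x y = piR x' y' <-> perm_eq x x' /\ perm_eq y y'.
Proof.
split.
- move=> /(@eq_from_Tagged _ (fun s : levi_type n =>
    temperedR_shape (val s).1 (val s).2) _ _ _).
  move=> /param_classP[[g h] [[El Ee] [Et Et']]].
  by split; apply/perm_actP; [exists g|exists h].
- move=> [/perm_actP[g [El Et]] /perm_actP[h [Ee Et']]]; congr existT.
  apply/param_classP; exists (g, h); rewrite /= /prod_act /=.
  by split; congr (_, _).
Qed.

(** ** Base change *)

(** chi_1, chi_1^tau, ..., chi_q, chi_q^tau, xi_1 o N, ..., xi_r o N *)
Definition bc_seq (x : seq dsChar) (y : seq (charR R)) : seq (charC R) :=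
  flatten [seq [:: charC_of_ds c; char_tau (charC_of_ds c)] | c <- x]
  ++ [seq char_norm c | c <- y].

Lemma size_bc_seq n (s : levi_type n) (x : (val s).1.-tuple dsChar)
  (y : (val s).2.-tuple (charR R)) : size (bc_seq x y) == n.
Proof.
case: s x y => -[q r] /= /eqP -> x y; apply/eqP.
rewrite /bc_seq size_cat size_flatten /seq.shape -map_comp size_map size_tuple.
congr addn; rewrite -[X in _ = (2 * X)%N](size_tuple x).
by elim: (tval x) => //= c u ->; rewrite mulnS.
Qed.

Definition bc_tuple n (s : levi_type n) (x : (val s).1.-tuple dsChar)
    (y : (val s).2.-tuple (charR R)) : n.-tuple (charC R) :=
  Tuple (size_bc_seq x y).

(** computed on chosen inducing data; independent of the choice by [BC_piR] *)
Definition BC n (p : temperedR n) : temperedC n :=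
  let: existT s p' := p in
  let: ((l, e), (t, t')) := param_repr p' in
  piC (@bc_tuple n s [tuple (l i, t 0 i) | i < (val s).1]
                     [tuple (e j, t' 0 j) | j < (val s).2]).

Lemma perm_bc_seq x x' y y' :
  perm_eq x x' -> perm_eq y y' -> perm_eq (bc_seq x y) (bc_seq x' y').
Proof.
by move=> xx' yy'; apply: perm_cat; rewrite ?perm_flatten ?perm_map.
Qed.

Lemma perm_eq_act (A : eqType) n (f : {ffun 'I_n -> A}) (v : 'rV[R]_n)
    (c : n.-tuple (A * R)) g :
  perm_ffun f g = [ffun i => (tnth c i).1] ->
  perm_rV v g = \row_i (tnth c i).2 ->
  perm_eq [tuple (f i, v 0 i) | i < n] c.
Proof.
move=> /ffunP/= E1 /rowP/= E2; rewrite perm_sym.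
apply/(@tuple_permP _ n _ [tuple (f i, v 0 i) | i < n]).
exists g^-1%g; congr tval; apply: eq_from_tnth => i.
have := E1 i; have := E2 i; rewrite !tnth_mktuple !(ffunE, mxE).
by case: (tnth c i) => a b /= <- <-.
Qed.

Lemma BC_piR n (s : levi_type n) (x : (val s).1.-tuple dsChar)
    (y : (val s).2.-tuple (charR R)) :
  BC (piR x y) = piC (bc_tuple x y).
Proof.
rewrite /BC /piR; case E: (param_repr _) => [[l e] [t t']].
apply/piC_eq; have := param_reprK (projT2 (piR x y)).
rewrite /piR [projT2 _]/= E /= => /param_classP[[g h] /= [[El Ee] [Et Et']]].
by apply: perm_bc_seq; [exact: (perm_eq_act El Et)|exact: (perm_eq_act Ee Et')].
Qed.

End TemperedDuals.

(** for maps between locally compact Hausdorff spaces *)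
Definition proper_map (X Y : topologicalType) (f : X -> Y) : Prop :=
  forall K : set Y, compact K -> compact (f @^-1` K).

(* Main.v *)
(** For a finite group, the projection from coordinates with a fixed label to
    the parameter space is continuous, open and proper, and a compact set of
    parameters involves only finitely many labels.  On inducing data base change
    is a map (l, v) |-> (lambda l, A v): A lists every t_i twice and every
    2 t'_j once, so it has a continuous left inverse and is proper, while lambda
    has finite fibres because it lists the l_i and forgets only the signs eps_j.
    Hence the preimage of a compact set is a finite union of compact images. *)

From HB Require Import structures.
Require Import Defs.
From mathcomp Require Import all_boot all_order all_fingroup all_algebra.
From mathcomp Require Import all_classical all_reals all_analysis.
From mathcomp Require Import generic_quotient finmap.

Set Implicit Arguments.
Unset Strict Implicit.
Unset Printing Implicit Defensive.
Import Order.TTheory GRing.Theory Num.Theory.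
Import numFieldNormedType.Exports.
Local Open Scope classical_set_scope.
Local Open Scope ring_scope.
Local Open Scope quotient_scope.

(** * Compactness, properness and continuity in general spaces *)

(** A point of [K] makes [T] pointed, as [compact_cover] requires; the empty set is covered by the
    empty subfamily. *)
Lemma compact_cover_compact (T : topologicalType) (K : set T) :
  compact K -> cover_compact K.
Proof.
have [->|/set0P[k _]] := eqVneq K set0.
  by move=> _ I D f _ _; exists fset0.
pose pT := HB.pack_for ptopologicalType T (isPointed.Build T k).
by move=> Kc; have := Kc : @compact pT K; rewrite compact_cover.
Qed.

Lemma bigcup_compact (T : topologicalType) (I : choiceType) (D : set I)
    (F : I -> set T) : finite_set D ->
  (forall i, D i -> compact (F i)) -> compact (\bigcup_(i in D) F i).
Proof.
move=> finD Fc; rewrite -fsbig_setU// fsbig_finite//= big_seq.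
apply: bigsetU_compact => i.
by rewrite in_fset_set// => /set_mem; exact: Fc.
Qed.

Lemma proper_left_inverse (V W : topologicalType) (A : V -> W) (B : W -> V) :
  hausdorff_space W -> continuous A -> continuous B -> cancel A B ->
  proper_map A.
Proof.
move=> hW Ac Bc AK K Kc.
apply: (@subclosed_compact _ _ (B @` K)).
- by apply: closed_comp => [? _|]; [exact: Ac|exact: compact_closed].
- by apply: continuous_compact => //; exact: continuous_subspaceT.
- by move=> v Kv; exists (A v); rewrite ?AK.
Qed.

Lemma continuous_mx (X : topologicalType) (T : topologicalType) m n
    (f : X -> 'M[T]_(m, n)) :
  (forall i j, continuous (fun x => f x i j)) -> continuous f.
Proof.
move=> fc x B [P Pn sPB].
have : \forall y \near x, forall i j, P i j (f y i j).
  apply: filter_forall => i; apply: filter_forall => j.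
  exact: (fc i j x) (Pn i j).
by apply: filterS => y Py; apply: sPB.
Qed.

Lemma continuous_pair (X Y Z : topologicalType) (f : X -> Y) (g : X -> Z) :
  continuous f -> continuous g -> continuous (fun x => (f x, g x)).
Proof. by move=> fc gc x; apply: cvg_pair; [exact: fc|exact: gc]. Qed.

Lemma prod_act_continuous (gT hT : finGroupType) (T U : topologicalType)
    (a : {action gT &-> T}) (b : {action hT &-> U}) :
  (forall g, continuous (a^~ g)) -> (forall h, continuous (b^~ h)) ->
  forall gh, continuous ((prod_action a b)^~ gh).
Proof.
move=> ac bc [g h] [x y]; apply: cvg_pair.
- by apply: (@continuous_comp _ _ _ fst (a^~ g) (x, y));
    [exact: cvg_fst|exact: ac].
- by apply: (@continuous_comp _ _ _ snd (b^~ h) (x, y));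
    [exact: cvg_snd|exact: bc].
Qed.

Lemma quotient_openE (T : topologicalType) (Q : quotType T)
    (A : set (quotient_topology Q)) :
  open A = open (\pi_(quotient_topology Q) @^-1` A).
Proof. by []. Qed.

(** * Topology of the parameter space of a finite group action *)

Section ParamTopology.
Variables (gT : finGroupType) (L : choiceType) (V : topologicalType).
Variables (aL : {action gT &-> L}) (aV : {action gT &-> V}).
Hypothesis aV_cont : forall g, continuous (aV^~ g).
Local Notation Z := (param_space aL aV).
Local Notation cls := (param_class aL aV).

Lemma pi_param_class (o : label_orbit aL) v :
  existT (stratum aV) o (\pi_({eq_quot stab_rel aL aV (repr o)}) v) =
  cls (repr o) v.
Proof.
have oE : label_class aL (repr o) = o by exact: reprK.
by rewrite (param_classE _ _ oE (tact1 aL _)) tact1.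
Qed.

(** Each stratum is a quotient of [V] through the class map at the representative label, so the
    class maps detect open sets. *)
Lemma open_paramP (A : set Z) :
  (forall l, open (cls l @^-1` A)) -> open A.
Proof.
move=> Ao; apply/sigT_openP => o.
rewrite [open _]quotient_openE.
rewrite (_ : _ @^-1` _ = cls (repr o) @^-1` A); first exact: Ao.
by apply/seteqP; split => v /=; rewrite pi_param_class.
Qed.

Lemma continuous_paramP (Y : topologicalType) (f : Z -> Y) :
  (forall l, continuous (f \o cls l)) -> continuous f.
Proof.
move=> fc; apply/continuousP => A oA; apply: open_paramP => l.
by move/continuousP: (fc l); exact.
Qed.

(** With [g] carrying [l] to its representative, [cls l] is the action of [g], then the quotient
    map, then the inclusion of a summand. *)
Lemma param_class_continuous l : continuous (cls l).
Proof.
have [g /eqP lg] := to_repr_subproof aL l.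
have -> : cls l = (fun w => existT (stratum aV) (label_class aL l)
    (\pi_({eq_quot stab_rel aL aV (repr (label_class aL l))}) w)) \o aV^~ g.
  by apply/funext => v; rewrite /= (param_classE aV v (erefl _) lg).
move=> v; apply: continuous_comp; first exact: aV_cont.
apply: (@continuous_comp _ _ _ (\pi_(quotient_topology {eq_quot _}))).
  exact: pi_continuous.
exact: existT_continuous.
Qed.

(** Pulled back along any [cls l'], the image becomes a union of translates of [U]. *)
Lemma param_class_open l (U : set V) : open U -> open (cls l @` U).
Proof.
move=> oU; apply: open_paramP => l'.
rewrite (_ : _ @^-1` _ = \bigcup_(g in [set g | aL l' g = l]) (aV^~ g @^-1` U)).
  by apply: bigcup_open => g _; move/continuousP: (aV_cont (g := g)); exact.
apply/seteqP; split=> [v [u Uu /esym/param_classP[g [lg vg]]]|v [g lg Ug]].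
  by exists g => //=; rewrite vg.
by exists (aV v g) => //; apply/esym/param_classP; exists g.
Qed.

(** The images of the class maps form an open cover, so finitely many labels cover [K]; every label
    occurring in [K] lies in the orbit of one of these, and orbits are finite. *)
Lemma finite_param_labels (K : set Z) :
  compact K -> finite_set [set l | exists v, K (cls l v)].
Proof.
move=> /compact_cover_compact/(_ L setT (fun l => cls l @` setT)) [].
- by move=> l _; exact/param_class_open/openT.
- move=> x _; rewrite -(param_reprK x); exists (param_repr x).1 => //=.
  by exists (param_repr x).2.
move=> D _ KD.
apply: (@sub_finite_set _ _ (\bigcup_(l in [set` D]) range (aL l))).
  move=> l [v /KD[l' Dl' [u _ /param_classP[g [<- _]]]]].
  by exists l' => //; exists g.
apply: bigcup_finite => // l _; exact/finite_image/finite_finset.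
Qed.

(** If the projection of an ultrafilter F clusters at the class of v', then for
    each neighborhood of v' some group element carries F into it; as the group
    is finite, one element works for all neighborhoods. *)
Lemma param_class_proper l : proper_map (cls l).
Proof.
move=> K Kc; rewrite compact_ultra => F FU FK.
have [x [Kx Fx]] := Kc _ (fmap_proper_filter (cls l) _) FK.
move: Kx Fx; rewrite -(param_reprK x).
move: (param_repr x) => [l' v'] /= {x} Kx Fx.
have FsU U : open_nbhs v' U -> exists g, aL l g = l' /\ F (aV^~ g @^-1` U).
  move=> [oU Uv']; apply: contrapT => noF.
  have : F (\bigcap_(g in [set g | aL l g = l']) ~` (aV^~ g @^-1` U)).
    have : \forall v \near F, forall g, aL l g = l' -> ~ U (aV v g).
      apply: filter_forall => g.
      have [lg|nlg] := pselect (aL l g = l'); last first.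
        by apply: filterS filterT => v _ /nlg.
      have [FU'|] := in_ultra_setVsetC (aV^~ g @^-1` U) FU.
        by case: noF; exists g.
      by apply: filterS => v nU _; exact: nU.
    by apply: filterS => v + g => /[apply].
  move=> FC.
  have [||_ [[v Cv <-] [u Uu /esym/param_classP[g [lg vg]]]]] :=
      Fx (cls l @` (\bigcap_(g in [set g | aL l g = l']) ~` (aV^~ g @^-1` U)))
         (cls l' @` U).
  - by apply: (@filterS _ F _ _ _ _ FC) => v Cv; exists v.
  - by apply: open_nbhs_nbhs; split; [exact: param_class_open|exists v'].
  - by apply: (Cv g lg) => /=; rewrite vg.
(* If each admissible [g] failed on some [U g], the intersection of all [U g] would contradict
   [FsU]. For [g] not carrying [l] to [l'], the whole space serves as a default [U g]. *)
have [g [lg Fg]] : exists g, aL l g = l' /\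
    forall U, open_nbhs v' U -> F (aV^~ g @^-1` U).
  apply: contrapT => nog.
  have Ug g : exists U, open_nbhs v' U /\
      (aL l g = l' -> ~ F (aV^~ g @^-1` U)).
    have [[U [Uo FnU]]|nU] := pselect (exists U, open_nbhs v' U /\
        ~ F (aV^~ g @^-1` U)); first by exists U.
    have [lg|nlg] := pselect (aL l g = l'); last first.
      by exists setT; split=> //; split=> //; exact: openT.
    case: nog; exists g; split=> // U Uo; apply: contrapT => FnU.
    by apply: nU; exists U.
  have [U Uo] := choice Ug.
  have : nbhs v' (\bigcap_(g in [set: gT]) U g).
    have : \forall v \near v', forall g, U g v.
      by apply: filter_forall => g; apply: open_nbhs_nbhs; case: (Uo g).
    by apply: filterS => v Uv g _; exact: Uv.
  rewrite nbhsE => -[W Wo WU]; have [g [lg FW]] := FsU _ Wo.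
  by have [_ /(_ lg)] := Uo g; apply; apply: filterS FW => v /WU; exact.
(* As [g] carries [F] to a filter converging to [v'], the filter [F] itself converges to the
   translate of [v'] by the inverse of [g]. *)
exists (aV v' g^-1%g); split=> /=.
  rewrite [cls _ _](_ : _ = cls l' v')//; apply/param_classP; exists g.
  by split=> //; rewrite -[X in aV _ X]invgK tactK.
move=> N; rewrite nbhs_simpl => vN.
have : nbhs v' (aV^~ g^-1%g @^-1` N) by exact: (aV_cont (g := g^-1%g)).
rewrite nbhsE => -[W Wo WN].
by apply: filterS (Fg _ Wo) => v /WN; rewrite /= tactK.
Qed.

End ParamTopology.

(** * Maps of parameter spaces induced by maps of labels and coordinates *)

Section ParamMaps.
Variables (gT gT' : finGroupType) (L L' : choiceType).
Variables (V V' : topologicalType).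
Variables (aL : {action gT &-> L}) (aV : {action gT &-> V}).
Variables (aL' : {action gT' &-> L'}) (aV' : {action gT' &-> V'}).
Hypothesis aV_cont : forall g, continuous (aV^~ g).
Hypothesis aV'_cont : forall g, continuous (aV'^~ g).
Variables (f : param_space aL aV -> param_space aL' aV').
Variables (lam : L -> L') (A : V -> V').
Hypothesis fE : forall l v,
  f (param_class aL aV l v) = param_class aL' aV' (lam l) (A v).
Hypothesis A_cont : continuous A.

Lemma param_map_continuous : continuous f.
Proof.
apply: continuous_paramP => l.
rewrite (_ : _ \o _ = param_class aL' aV' (lam l) \o A); last first.
  by apply/funext => v /=; rewrite fE.
by move=> v; apply: continuous_comp; [exact: A_cont|
  exact: param_class_continuous].
Qed.

Lemma param_map_proper :
  (forall S, finite_set S -> finite_set (lam @^-1` S)) -> proper_map A ->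
  proper_map f.
Proof.
move=> lam_fin A_proper K Kc.
pose S := [set l | exists v, K (param_class aL' aV' l v)].
rewrite (_ : f @^-1` K = \bigcup_(l in lam @^-1` S)
    (param_class aL aV l @` (A @^-1` (param_class aL' aV' (lam l) @^-1` K)))).
  apply: bigcup_compact => [|l _].
    exact/lam_fin/finite_param_labels.
  apply: continuous_compact.
    exact/continuous_subspaceT/param_class_continuous.
  exact/A_proper/param_class_proper.
apply/seteqP; split=> [x|_ [l _ [v Kv <-]]]; last by rewrite /= fE.
rewrite /= -(param_reprK x) fE => Kx.
by exists (param_repr x).1; [exists (A (param_repr x).2)|
  exists (param_repr x).2].
Qed.

End ParamMaps.

(** * Base change for a fixed Levi type *)

Section BaseChange.
Variable R : realType.

Lemma mx_hausdorff m n : hausdorff_space 'M[R]_(m, n).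
Proof.
move=> p q pq; apply/matrixP => i j.
apply: (@norm_hausdorff _ R^o) => A B Ap Bq.
have [||M [AM BM]] := pq ((fun M => M i j) @^-1` A) ((fun M => M i j) @^-1` B).
- exact: (@coord_continuous R m n i j p).
- exact: (@coord_continuous R m n i j q).
- by exists (M i j).
Qed.

Lemma perm_rV_continuous n (g : 'S_n) :
  continuous (fun v => perm_rV_action R n v g).
Proof.
apply: continuous_mx => i j.
rewrite (_ : (fun _ => _) = fun v : 'rV[R]_n => v i (g^-1%g j)).
  exact: coord_continuous.
by apply/funext => v; rewrite /= /perm_rV mxE.
Qed.

(** The positions in [bc_seq]: chi_i, chi_i^tau are at [inl (i, false)],
    [inl (i, true)] and xi_j o N is at [inr j]. *)
Definition bc_index q r : seq ('I_q * bool + 'I_r) :=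
  flatten [seq [:: inl (i, false); inl (i, true)] | i <- enum 'I_q] ++
  [seq inr j | j <- enum 'I_r].

Definition bc_label q r (l : 'I_q -> int) (c : 'I_q * bool + 'I_r) : int :=
  match c with inl (i, b) => if b then - l i else l i | inr _ => 0 end.

Definition bc_coord q r (v : 'rV[R]_q * 'rV[R]_r)
    (c : 'I_q * bool + 'I_r) : R :=
  match c with inl (i, _) => v.1 0 i | inr j => 2 * v.2 0 j end.

Lemma mem_bc_index q r c : c \in bc_index q r.
Proof.
rewrite mem_cat; case: c => [[i b]|j]; apply/orP; [left|right].
  by apply/flatten_mapP; exists i; rewrite ?mem_enum//; case: b;
    rewrite !inE eqxx ?orbT.
by rewrite map_f// mem_enum.
Qed.

Lemma size_bc_index n (s : levi_type n) :
  size (bc_index (val s).1 (val s).2) == n.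
Proof.
case: s => -[q r] /= /eqP ->; rewrite size_cat size_map size_enum_ord.
rewrite eqn_add2r -[X in (2 * X)%N](size_enum_ord q); apply/eqP.
by elim: (enum 'I_q) => //= i u ->; rewrite mulnS.
Qed.

(** Listing the characters over a fixed index sequence separates the dependence on labels from that
    on coordinates. *)
Lemma bc_seq_index q r (l : 'I_q -> dsLabel) (e : 'I_r -> bool)
    (v : 'rV[R]_q * 'rV[R]_r) :
  bc_seq [tuple (l i, v.1 0 i) | i < q] [tuple (e j, v.2 0 j) | j < r] =
  [seq (bc_label (val \o l) c, bc_coord v c) | c <- bc_index q r].
Proof.
by rewrite /bc_seq /bc_index map_cat map_flatten -!map_comp.
Qed.

Section Shape.
Variables (n : nat) (s : levi_type n).
Local Notation q := (val s).1.
Local Notation r := (val s).2.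
Local Notation aL := (prod_action (perm_ffun_action dsLabel q)
  (perm_ffun_action bool r)).
Local Notation aV := (prod_action (perm_rV_action R q) (perm_rV_action R r)).

Definition bc_tindex : n.-tuple ('I_q * bool + 'I_r) := Tuple (size_bc_index s).

Definition shape_label (l : {ffun 'I_q -> dsLabel} * {ffun 'I_r -> bool}) :
  {ffun 'I_n -> int} := [ffun k => bc_label (val \o l.1) (tnth bc_tindex k)].

Definition shape_coord (v : 'rV[R]_q * 'rV[R]_r) : 'rV[R]_n :=
  \row_k bc_coord v (tnth bc_tindex k).

Definition BC_shape (x : temperedR_shape R q r) : temperedC R n :=
  BC (existT (fun s : levi_type n => temperedR_shape R (val s).1 (val s).2)
    s x).

(** This is the form in which the results on induced maps of parameter spaces apply to base
    change. *)
Lemma BC_shapeE l v : BC_shape (param_class aL aV l v) =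
  param_class (perm_ffun_action int n) (perm_rV_action R n)
    (shape_label l) (shape_coord v).
Proof.
pose x := [tuple (l.1 i, v.1 0 i) | i < q].
pose y := [tuple (l.2 j, v.2 0 j) | j < r].
have -> : BC_shape (param_class aL aV l v) = BC (piR x y).
  rewrite /BC_shape /piR; congr (BC (existT _ s (param_class _ _ _ _))).
    by case: l @x @y => l e; congr pair; apply/ffunP => i;
      rewrite !ffunE tnth_mktuple.
  by case: v @x @y => t t'; congr pair; apply/rowP => i;
    rewrite !mxE tnth_mktuple.
rewrite BC_piR /piC.
have -> : bc_tuple x y =
    [tuple of [seq (bc_label (val \o l.1) c, bc_coord v c) | c <- bc_tindex]].
  by apply/val_inj; exact: bc_seq_index.
by congr param_class; [apply/ffunP|apply/rowP] => k;
  rewrite ?(ffunE, mxE) tnth_map.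
Qed.

Lemma bc_tindex_surj c : exists k, tnth bc_tindex k = c.
Proof.
have /tnthP[k ->] : c \in bc_tindex by exact: mem_bc_index.
by exists k.
Qed.

(** Adjoining the signs makes the map injective, since the entry at [inl (i, false)] recovers the
    label of [chi_i]; there are finitely many sign vectors. *)
Lemma shape_label_finite S : finite_set S -> finite_set (shape_label @^-1` S).
Proof.
move=> finS.
apply: (@sub_finite_set _ _
  ((fun l => (shape_label l, l.2)) @^-1` (S `*` [set: {ffun 'I_r -> bool}]))).
  by move=> l Sl; split.
apply: finite_preimage; last by apply: finite_setX => //; exact: finite_finset.
move=> [l e] [l' e'] _ _ /= [/ffunP ll' ->]; congr pair.
apply/ffunP => i; apply/val_inj.
have [k kE] := bc_tindex_surj (inl (i, false)).
by have := ll' k; rewrite !ffunE kE.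
Qed.

Lemma shape_coord_continuous : continuous shape_coord.
Proof.
apply: continuous_mx => i k.
rewrite (_ : (fun _ => _) = fun v => bc_coord v (tnth bc_tindex k)); last first.
  by apply/funext => v; rewrite mxE.
case: (tnth _ k) => [[j b]|j] v /=.
  by apply: (@continuous_comp _ _ _ fst (fun w : 'rV[R]_q => w 0 j));
    [exact: cvg_fst|exact: coord_continuous].
apply: cvgM; first exact: cvg_cst.
by apply: (@continuous_comp _ _ _ snd (fun w : 'rV[R]_r => w 0 j));
  [exact: cvg_snd|exact: coord_continuous].
Qed.

(** A continuous left inverse reads [t_i] at a position [k1 i] of [chi_i] and halves the entry at a
    position [k2 j] of [xi_j o N]. *)
Lemma shape_coord_proper : proper_map shape_coord.
Proof.
have [k1 k1E] := choice (fun i => bc_tindex_surj (inl (i, false))).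
have [k2 k2E] := choice (fun j => bc_tindex_surj (inr j)).
apply: (@proper_left_inverse ('rV[R]_q * 'rV[R]_r)%type 'rV[R]_n _
  (fun w => (\row_i w 0 (k1 i), \row_j (w 0 (k2 j) / 2)))).
- exact: mx_hausdorff.
- exact: shape_coord_continuous.
- apply: continuous_pair.
  + apply: continuous_mx => i j.
    rewrite (_ : (fun _ => _) = fun w : 'rV[R]_n => w 0 (k1 j)).
      exact: coord_continuous.
    by apply/funext => u; rewrite mxE.
  + apply: continuous_mx => i j.
    rewrite (_ : (fun _ => _) = fun w : 'rV[R]_n => w 0 (k2 j) / 2).
      move=> w.
      apply: (@continuous_comp _ _ _ (fun u : 'rV[R]_n => u 0 (k2 j))
        ( *%R^~ 2^-1)).
        exact: coord_continuous.
      exact: mulrr_continuous.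
    by apply/funext => u; rewrite mxE.
- move=> [t t']; congr pair; apply/rowP => i; rewrite !mxE.
    by rewrite k1E.
  by rewrite k2E /= mulrC mulKf// pnatr_eq0.
Qed.

Lemma BC_shape_continuous : continuous BC_shape.
Proof.
apply: (param_map_continuous _ BC_shapeE).
- exact: perm_rV_continuous.
- exact: shape_coord_continuous.
Qed.

Lemma BC_shape_proper : proper_map BC_shape.
Proof.
apply: (param_map_proper _ _ BC_shapeE).
- by apply: prod_act_continuous; exact: perm_rV_continuous.
- exact: perm_rV_continuous.
- exact: shape_label_finite.
- exact: shape_coord_proper.
Qed.

End Shape.

(** * Gluing over the finitely many Levi types *)

Lemma finite_levi_type n : finite_set [set: levi_type n].
Proof.
apply: (@sub_finite_set _ _
  (val @^-1` [set p : nat * nat | (p.1 <= n)%N /\ (p.2 <= n)%N])).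
  move=> [[q r] /= /eqP nE] _ /=; split; rewrite [leqRHS]nE.
    by rewrite mul2n -addnn -addnA leq_addr.
  exact: leq_addl.
apply: finite_preimage; first by move=> s s' _ _; exact: val_inj.
rewrite (_ : [set _ | _] = `I_n.+1 `*` `I_n.+1); first exact: finite_setX.
by apply/seteqP; split=> -[q r].
Qed.

End BaseChange.

Theorem proposition5p3 (R : realType) (n : nat) (hn : (1 <= n)%N) :
  continuous (@BC R n : temperedR R n -> temperedC R n) /\
  proper_map (@BC R n : temperedR R n -> temperedC R n).
Proof.
split.
  (* Neighborhoods in a disjoint union are those of the summand, so continuity is checked on each
     summand. *)
  by move=> [s x] U; exact: (@BC_shape_continuous R n s x U).
move=> K Kc.
(* The preimage is split into its parts in the summands, each the image of a compact set under the
   inclusion. *)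
rewrite (_ : _ @^-1` K = \bigcup_(s in [set: levi_type n])
  (existT (fun s => temperedR_shape R (val s).1 (val s).2) s @`
    (@BC_shape R n s @^-1` K))); last first.
  apply/seteqP; split=> [[s x] Kx|_ [s _ [x Kx <-]]//].
  by exists s => //; exists x.
apply: bigcup_compact => [|s _]; first exact: finite_levi_type.
apply: continuous_compact; last exact: BC_shape_proper.
by apply: continuous_subspaceT => x U.
Qed.
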